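(* Let $a,b,\alpha\in\mathbb{R}$ and $l>0$, and let $$P(x,y)=y\{(x-a)^2+(y-b)^2-l^2\}-l\{(x-a)\sin\alpha-(y-b)\cos\alpha\}(x^2+y^2-1)\in\mathbb{R}[x,y],$$ so that $P(x,y)=0$ is the equation of the edge of the angular Voronoi diagram of the line segment $s_1$ with endpoints $(\pm1,0)$ and the line segment $s_2$ of length $2l$, midpoint $(a,b)$ and direction angle $\alpha$. If $P$ has total degree exactly three and is factorable (i.e. is a product of two non-constant polynomials in $\mathbb{R}[x,y]$), then $P$ is the product of the equation of a circle and the equation of a line; that is, there are real numbers $c\neq 0$, $d,e,f$ and real numbers $b_1,b_2,b_3$ with $(b_1,b_2)\neq(0,0)$ such that $$P(x,y)=\bigl(c(x^2+y^2)+dx+ey+f\bigr)\,(b_1y+b_2x+b_3).$$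
   Context: For a line segment $s$ and a point $p$ in the plane, the visual angle $\theta_p(s)\in[0,\pi]$ is the angle formed by the two rays emanating from $p$ through the two endpoints of $s$. For a finite set of line segments $s_1,\dots,s_n$, the angular Voronoi region of $s_i$ is the set of points $p\in\mathbb{R}^2$ with $\theta_p(s_i)<\theta_p(s_j)$ for all $j\neq i$, and the edge of $s_i,s_j$ is the set of $p$ with $\theta_p(s_i)=\theta_p(s_j)<\theta_p(s_k)$ for all $k\neq i,j$. Convention: coordinates are chosen so that $s_1$ has endpoints $(1,0)$ and $(-1,0)$ (any pair of segments can be brought to this form by a similarity), and $s_2$ has length $2l$, midpoint $(a,b)$ and makes angle $\alpha$ with the $x$-axis. The ''equation of the edge'' is then $P(x,y)=0$ with $P$ as in the claim. (The angles $\alpha$ and $\alpha+\pi$ describe the same segment but give different polynomials; the claim concerns $P$ for every real $\alpha$.) ''Circle'' means an equation $c(x^2+y^2)+dx+ey+f=0$ with $c\ne0$; its radius is not required to be positive and may be $0$ or imaginary. *)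

(* Defs.v *)
From HB Require Import structures.
From mathcomp Require Import all_boot all_order all_algebra.
From mathcomp Require Import reals trigo.
From mathcomp Require Import mpoly.

Set Implicit Arguments.
Unset Strict Implicit.
Unset Printing Implicit Defensive.

Import GRing.Theory Num.Theory.
Local Open Scope ring_scope.

Definition polyx (R : realType) : {mpoly R[2]} := 'X_ord0.
Definition polyy (R : realType) : {mpoly R[2]} := 'X_ord_max.
Arguments polyx {R}.
Arguments polyy {R}.

(* Edge of the angular Voronoi diagram of the segment with endpoints (-1,0),
   (1,0) and the segment of length 2l, midpoint (a,b) and direction angle
   alpha.  Replacing alpha by alpha + pi gives the same second segment but a
   different polynomial. *)
Definition edge_poly (R : realType) (a b alpha l : R) : {mpoly R[2]} :=
  polyy * ((polyx - a%:MP) ^+ 2 + (polyy - b%:MP) ^+ 2 - (l ^+ 2)%:MP)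
  - l%:MP * ((polyx - a%:MP) * (sin alpha)%:MP
             - (polyy - b%:MP) * (cos alpha)%:MP)
          * (polyx ^+ 2 + polyy ^+ 2 - 1).

(* [msize p] is 1 + the total degree of [p], and 0 for [p = 0], so
   [1 < msize p] says that [p] is not constant. *)
Definition factorable (R : realType) (p : {mpoly R[2]}) : Prop :=
  exists q r : {mpoly R[2]},
    [/\ (1 < msize q)%N, (1 < msize r)%N & p = q * r].

(* With c != 0, a circle; its radius may be zero or imaginary. *)
Definition circle_poly (R : realType) (c d e f : R) : {mpoly R[2]} :=
  c%:MP * (polyx ^+ 2 + polyy ^+ 2) + d%:MP * polyx + e%:MP * polyy + f%:MP.

Definition line_poly (R : realType) (b1 b2 b3 : R) : {mpoly R[2]} :=
  b1%:MP * polyy + b2%:MP * polyx + b3%:MP.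

(* Main.v *)
(** The cubic part of the edge polynomial is [(x^2 + y^2) m] with
    [m = (1 + l cos alpha) y - l (sin alpha) x].  A factorization of a cubic
    is into a quadratic [q] and a line [r], so [(x^2 + y^2) m] is the product
    of the quadratic part of [q] and the linear part [r1] of [r].  Over the
    reals [x^2 + y^2] does not vanish on the line [r1 = 0], so [m] does, hence
    [m = k r1] and the quadratic part of [q] is [k (x^2 + y^2)]. *)

Require Import Defs.
From HB Require Import structures.
From mathcomp Require Import all_boot all_order all_algebra.
From mathcomp Require Import ring lra.
From mathcomp Require Import reals trigo.
From mathcomp Require Import mpoly.

Import GRing.Theory Num.Theory.
Local Open Scope ring_scope.

Lemma monomial2E (R : realType) (i j : nat) :
  polyx ^+ i * polyy ^+ j = 'X_[[multinom [tuple i; j]]] :> {mpoly R[2]}.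
Proof.
rewrite mpolyXE_id big_ord_recl big_ord1 !multinomE /= /polyx /polyy.
by congr (_ * 'X__ ^+ _); apply: val_inj.
Qed.

Lemma multinom2_eq (i j : nat) (m : 'X_{1..2}) :
  ([multinom [tuple i; j]] == m) = ((i == m ord0) && (j == m ord_max)).
Proof.
have mE (k : 'I_2) : k = ord0 \/ k = ord_max.
  by case: k => [[|[|//]]] ?; [left | right]; apply: val_inj.
apply/eqP/andP => [<- | [/eqP -> /eqP ->]]; first by rewrite !multinomE.
by apply/mnmP => k; case: (mE k) => ->; rewrite multinomE.
Qed.

Lemma mdeg2E (m : 'X_{1..2}) : mdeg m = (m ord0 + m ord_max)%N.
Proof.
by rewrite mdegE big_ord_recl big_ord1; congr (_ + m _)%N; apply: val_inj.
Qed.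

(** Both sides have the same coefficient at every monomial; the triangular range [i + j < k] is the
    degree bound. *)
Lemma mpoly2wE (R : realType) (k : nat) (p : {mpoly R[2]}) :
  (msize p <= k)%N ->
  p = \sum_(i < k) \sum_(j < k - i)
        (p@_[multinom [tuple val i; val j]])%:MP * (polyx ^+ i * polyy ^+ j).
Proof.
(* Widening the inner range to [j < k] under the condition [i + j < k] turns the double sum into one
   over pairs. *)
move=> pk; apply/mpolyP => m; under eq_bigr => i _.
  rewrite (big_ord_widen k (fun j => (p@_[multinom [tuple val i; j]])%:MP
            * (polyx ^+ i * polyy ^+ j))) ?leq_subr //.
  under eq_bigl do rewrite ltn_subRL; over.
rewrite pair_big_dep /= raddf_sum /=.
under eq_bigr => ij _.
  rewrite mcoeffCM monomial2E mcoeffX multinom2_eq; over.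
(* In degree at least [k] both coefficients are 0; below it only the pair of exponents of [m]
   contributes. *)
have [mk|mk] := ltnP (mdeg m) k; last first.
  rewrite memN_msupp_eq0 ?msize_mdeg_ge ?(leq_trans pk) //.
  rewrite big1 // => -[i j] /= ijk; case: andP => [[/eqP ei /eqP ej]|]; last first.
    by rewrite mulr0.
  by move: mk; rewrite mdeg2E -ei -ej leqNgt ijk.
move: (mk); rewrite mdeg2E => mk'.
have m0k : (m ord0 < k)%N by rewrite (leq_ltn_trans _ mk') ?leq_addr.
have m1k : (m ord_max < k)%N by rewrite (leq_ltn_trans _ mk') ?leq_addl.
have mE : [multinom [tuple m ord0; m ord_max]] = m.
  by apply/eqP; rewrite multinom2_eq !eqxx.
rewrite (bigD1 (Ordinal m0k, Ordinal m1k)) //= mE big1 => [|[i j] /= /andP[_]].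
  by rewrite eqxx andTb eqxx mulr1 addr0.
by rewrite xpair_eqE -!val_eqE /= => /negbTE ->; rewrite mulr0.
Qed.

Lemma bivariate_sum2 (S : comNzRingType) (F : nat -> nat -> S) (x y : S) :
  \sum_(i < 2) \sum_(j < 2 - i) F i j * (x ^+ i * y ^+ j)
  = F 0%N 1%N * y + F 1%N 0%N * x + F 0%N 0%N.
Proof. by rewrite !(big_ord_recl, big_ord0) /=; ring. Qed.

Lemma bivariate_sum3 (S : comNzRingType) (F : nat -> nat -> S) (x y : S) :
  \sum_(i < 3) \sum_(j < 3 - i) F i j * (x ^+ i * y ^+ j)
  = F 2%N 0%N * x ^+ 2 + F 1%N 1%N * (x * y) + F 0%N 2%N * y ^+ 2
    + (F 0%N 1%N * y + F 1%N 0%N * x + F 0%N 0%N).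
Proof. by rewrite !(big_ord_recl, big_ord0) /=; ring. Qed.

Lemma mpoly2_affine (R : realType) (p : {mpoly R[2]}) :
  (msize p <= 2)%N -> exists u v w, p = line_poly u v w.
Proof.
(* The witnesses are the coefficients of [p], read off from the expanded sum. *)
move=> /mpoly2wE pE; do 3!eexists; rewrite {1}pE.
exact: (bivariate_sum2 _ (fun i j => (p@_[multinom [tuple i; j]])%:MP)).
Qed.

Lemma mpoly2_quadratic (R : realType) (p : {mpoly R[2]}) :
  (msize p <= 3)%N ->
  exists A B C u v w, p = A%:MP * polyx ^+ 2 + B%:MP * (polyx * polyy)
                          + C%:MP * polyy ^+ 2 + line_poly u v w.
Proof.
move=> /mpoly2wE pE; do 6!eexists; rewrite {1}pE.
exact: (bivariate_sum3 _ (fun i j => (p@_[multinom [tuple i; j]])%:MP)).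
Qed.

Lemma msize_line_poly (R : realType) (u v w : R) :
  (msize (line_poly u v w) <= 2)%N.
Proof.
have msizeCX c i : (msize (c%:MP * 'X_i : {mpoly R[2]}) <= 2)%N.
  by rewrite mul_mpolyC (leq_trans (msizeZ_le _ _)) // msizeX mdeg1.
rewrite /line_poly (leq_trans (msizeD_le _ _)) // geq_max msizeC.
by rewrite (leq_trans (msizeD_le _ _)) ?geq_max ?msizeCX //; case: eqP.
Qed.

Lemma edge_poly_cubic_part (R : realType) (a b alpha l A B C u v w u' v' w' : R) :
  edge_poly a b alpha l =
    (A%:MP * polyx ^+ 2 + B%:MP * (polyx * polyy) + C%:MP * polyy ^+ 2
     + line_poly u v w) * line_poly u' v' w' ->
  forall x y,
    (x ^+ 2 + y ^+ 2) * ((1 + l * cos alpha) * y - l * sin alpha * x)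
    = (A * x ^+ 2 + B * (x * y) + C * y ^+ 2) * (u' * y + v' * x).
Proof.
move=> eP x y.
(* The third difference in [t] of [f (t x, t y)] at [-1, 0, 1, 2] retains
   only the cubic part. *)
have ev t := congr1 (meval (fun i => t * (if i == ord0 then x else y))) eP.
move: (ev (-1)) (ev 0) (ev 1) (ev 2%:R).
rewrite /edge_poly /line_poly /polyx /polyy.
rewrite !(mevalB, mevalD, mevalM, expr2, mevalC, mevalXU, meval1) /=.
by move: (sin alpha) (cos alpha) => s c; lra.
Qed.

(** The four coefficients of the product, [A v], [A u + B v], [B u + C v] and [C u], vanish. This
    triangular system is solved from [A] upwards if [v] is nonzero; otherwise [u] is nonzero and
    each equation reduces to one unknown. *)
Lemma quadratic_linear_eq0 (R : realType) (A B C u v : R) :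
  (u, v) != (0, 0) ->
  (forall x y, (A * x ^+ 2 + B * (x * y) + C * y ^+ 2) * (u * y + v * x) = 0) ->
  [/\ A = 0, B = 0 & C = 0].
Proof.
move=> uv0 H.
have Av : A * v = 0 by have := H 1 0; lra.
have Cu : C * u = 0 by have := H 0 1; lra.
have AuBv : A * u + B * v = 0 by have := H 1 1; have := H 1 (-1); lra.
have BuCv : B * u + C * v = 0 by have := H 1 1; have := H 1 (-1); lra.
have [v0|v0] := eqVneq v 0; last first.
  have A0 : A = 0 by apply: (mulIf v0); rewrite Av mul0r.
  have B0 : B = 0 by apply: (mulIf v0); move: AuBv; rewrite A0; lra.
  by split=> //; apply: (mulIf v0); move: BuCv; rewrite B0; lra.
have u0 : u != 0 by apply: contraNneq uv0 => ->; rewrite v0.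
have kill z : z * u = 0 -> z = 0 by move=> zu; apply: (mulIf u0); rewrite zu mul0r.
move: AuBv BuCv; rewrite v0 !mulr0 !addr0 => /kill A0 /kill B0.
by split=> //; exact: kill.
Qed.

Lemma edge_poly_circle_line (R : realType) (a b alpha l : R) (q r : {mpoly R[2]}) :
  edge_poly a b alpha l = q * r -> msize q = 3%N -> msize r = 2%N ->
  exists c d e f b1 b2 b3 : R,
    [/\ c != 0,
        (b1, b2) != (0, 0)
      & edge_poly a b alpha l = circle_poly c d e f * line_poly b1 b2 b3].
Proof.
move=> eqr sq sr.
have [A [B [C [u [v [w qE]]]]]] := mpoly2_quadratic _ q (eq_leq sq).
have [b1 [b2 [b3 rE]]] := mpoly2_affine _ r (eq_leq sr).
have b12 : (b1, b2) != (0, 0).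
  apply/eqP => -[b10 b20]; move: sr.
  by rewrite rE /line_poly b10 b20 mpolyC0 !mul0r !add0r msizeC; case: eqP.
have cub := edge_poly_cubic_part _ _ _ _ _ _ _ _ _ _ _ _ _ _
  (etrans eqr (congr2 *%R qE rE)).
have n0 : b1 ^+ 2 + b2 ^+ 2 != 0.
  rewrite paddr_eq0 ?sqr_ge0 // !sqrf_eq0.
  by move: b12; rewrite xpair_eqE.
(* The coefficient vector of [m] is projected onto [(b1, b2)]; [k] is the ratio once the two are
   known to be parallel. *)
pose k := ((1 + l * cos alpha) * b1 - l * sin alpha * b2) / (b1 ^+ 2 + b2 ^+ 2).
have perp : (1 + l * cos alpha) * b2 + l * sin alpha * b1 = 0.
  (* The point [(b1, - b2)] lies on the line [b1 y + b2 x = 0], so the right side of [cub] vanishes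
     there. *)
  by apply: (mulfI n0); have := cub b1 (- b2); lra.
have mE : 1 + l * cos alpha = k * b1 /\ - (l * sin alpha) = k * b2.
  rewrite /k; split; apply: (mulIf n0); rewrite mulrAC divfK //.
    by have := congr1 ( *%R b2) perp; lra.
  by have := congr1 ( *%R b1) perp; lra.
case: mE => m1 m2.
(* Subtracting [k (x^2 + y^2)] from the quadratic part leaves a form whose product with
   [b1 y + b2 x] is zero. *)
have [|Ak B0 Ck] := quadratic_linear_eq0 R (A - k) B (C - k) b1 b2 b12.
  by move=> x y; have := cub x y; rewrite m1 -mulNr m2; lra.
have {}Ak : A = k by lra.
have {}Ck : C = k by lra.
exists k, v, u, w, b1, b2, b3; split=> //.
  (* With [k = 0] the factor [q] would be affine, against [msize q = 3]. *)
  apply/eqP => k0; move: sq; rewrite qE Ak B0 Ck k0 mpolyC0 !mul0r !add0r => sl.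
  by have := msize_line_poly _ u v w; rewrite sl.
rewrite eqr qE rE Ak B0 Ck mpolyC0; congr (_ * _).
by rewrite /line_poly /circle_poly mul0r addr0 mulrDr !addrA (addrAC _ (u%:MP * _)).
Qed.

Theorem theorem2 (R : realType) (a b alpha l : R) :
  0 < l ->
  msize (edge_poly a b alpha l) = 4%N ->
  factorable (edge_poly a b alpha l) ->
  exists c d e f b1 b2 b3 : R,
    [/\ c != 0,
        (b1, b2) != (0, 0)
      & edge_poly a b alpha l = circle_poly c d e f * line_poly b1 b2 b3].
Proof.
move=> _ s4 [q [r [sq sr eqr]]].
have n0 (p : {mpoly R[2]}) : (1 < msize p)%N -> p != 0.
  by apply: contraTneq => ->; rewrite msize0.
(* Degrees of nonzero factors add, so the two sizes sum to 5; each is at least 2, which leaves 3 and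
   2 in some order. *)
move: s4; rewrite eqr msizeM ?n0 // => s4.
have {s4} : (msize q == 3 /\ msize r == 2 \/ msize r == 3 /\ msize q == 2)%N.
  by move: sq sr s4; case: (msize q) (msize r) => [|[|[|[|n]]]] [|[|[|[|m]]]] //=;
    rewrite ?addSn ?addnS //; auto.
rewrite -eqr => -[[/eqP q3 /eqP r2]|[/eqP r3 /eqP q2]].
  exact: edge_poly_circle_line eqr q3 r2.
by apply: edge_poly_circle_line r3 q2; rewrite eqr mulrC.
Qed.
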